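(* Let $\mathfrak{o}$ be the valuation ring of a non-Archimedean local field with finite residue field $\mathfrak{o}_1$, and let $q=|\mathfrak{o}_1|$. For $n\geq 2$ let $T_n\leq\mathrm{GL}_n(\mathfrak{o}_1)$ be the subgroup of all invertible $n\times n$ matrices over $\mathfrak{o}_1$ whose first column is $(1,0,\dots,0)^T$ and whose second row is $(0,1,0,\dots,0)$, i.e. \[T_n=\begin{pmatrix}1&*&*&\dots&*\\0&1&0&\dots&0\\0&*&*&\dots&*\\\vdots&\vdots&\vdots&\ddots&\vdots\\0&*&*&\dots&*\end{pmatrix}\cong\mathfrak{o}_1^{n-1}\rtimes(\mathfrak{o}_1^{n-2}\rtimes \mathrm{GL}_{n-2}(\mathfrak{o}_1)).\] For $n\geq 1$ let $P_n\leq \mathrm{GL}_n(\mathfrak{o}_1)$ be the subgroup of all invertible $n\times n$ matrices over $\mathfrak{o}_1$ whose first row is $(1,0,\dots,0)$. Then the representation zeta polynomial of $T_n$ is given inductively by $\mathcal{R}_{T_2}(\mathcal{D})=q\mathcal{D}$ and, for $n\geq 3$, \[\mathcal{R}_{T_n}(\mathcal{D})=(q-1)\mathcal{R}_{\mathrm{GL}_{n-2}(\mathfrak{o}_1)}(\mathcal{D}^{q^{n-2}})+\mathcal{R}_{T_{n-1}}(\mathcal{D}^{q^{n-2}-1})+\mathcal{R}_{P_{n-1}}(\mathcal{D}).\]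
   Context: For a finite group $G$, $\mathrm{Irr}(G)$ denotes the set of irreducible complex representations of $G$ up to isomorphism. The representation zeta polynomial of $G$ is \[\mathcal{R}_G(\mathcal{D})=\sum_{\rho\in\mathrm{Irr}(G)}\mathcal{D}^{\dim\rho}\in\mathbb{Z}[\mathcal{D}],\] where $\mathcal{D}$ is an indeterminate; $\mathcal{R}_G(\mathcal{D}^k)$ denotes the polynomial obtained by substituting $\mathcal{D}^k$ for $\mathcal{D}$. In the displayed semidirect decomposition of $T_n$, the normal subgroup $\mathfrak{o}_1^{n-1}$ consists of the matrices $\begin{pmatrix}1&\mathbf{w}^T\\0&I\end{pmatrix}$ with $\mathbf{w}\in\mathfrak{o}_1^{n-1}$, and the complement $\mathfrak{o}_1^{n-2}\rtimes\mathrm{GL}_{n-2}(\mathfrak{o}_1)$ consists of the matrices $\begin{pmatrix}1&0\\0&Z\end{pmatrix}$ with $Z\in P_{n-1}$. The group $\mathrm{GL}_0(\mathfrak{o}_1)$ is trivial. *)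

(* Defs.v *)
From HB Require Import structures.
From mathcomp Require Import all_boot all_order all_algebra all_fingroup.
From mathcomp Require Import all_solvable all_field all_character.

Set Implicit Arguments.
Unset Strict Implicit.
Unset Printing Implicit Defensive.

Import GRing.Theory.
Local Open Scope ring_scope.

(* The library develops complex representation theory of finite groups over
   [algC]: [Iirr G] indexes the isomorphism classes of irreducible
   representations, ['Chi_i] is a representative of class [i], and
   [irr_degree (socle_of_Iirr i)] is the dimension of its underlying space. *)
Definition rep_zeta (gT : finGroupType) (G : {group gT}) : {poly int} :=
  \sum_(i : Iirr G) 'X^(irr_degree (socle_of_Iirr i)).

Section MatrixGroups.

(* [F] is the residue field of the valuation ring of a local field; the finite
   fields are exactly the residue fields that occur. *)
Variable F : finFieldType.

(* [{'GL_n[F]}] is the unit group of ['M[F]_n.-1.+1], so the library's ['GL_0]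
   is really GL_1; it is replaced here by the trivial group. *)
Definition GLn (n : nat) : {group {'GL_n[F]}} :=
  if n is 0 then 1%G else 'GL_n[F]%G.

(* Only meaningful for n >= 1. *)
Definition Pn_set (n : nat) : {set {'GL_n[F]}} :=
  [set g : {'GL_n[F]} | [forall j, GLval g 0 j == (0 == j)%:R]].

(* Only meaningful for n >= 2.  Indices start at 0, so the second row is the
   one of index 1. *)
Definition Tn_set (n : nat) : {set {'GL_n[F]}} :=
  [set g : {'GL_n[F]} | [forall i, GLval g i 0 == (i == 0)%:R]
         & [forall i, forall j, (val i == 1%N) ==>
              (GLval g i j == (i == j)%:R)]].

Fact Pn_group_set n : group_set (Pn_set n).
Proof.
apply/group_setP; split=> [|g h].
  by rewrite inE; apply/forallP=> j; rewrite GL_1E mxE.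
rewrite !inE => /forallP gP /forallP hP; apply/forallP => j.
rewrite GL_ME mxE (bigD1 0) //= (eqP (gP 0)) eqxx mul1r (eqP (hP j)).
rewrite big1 ?addr0 // => k k0; rewrite (eqP (gP k)) eq_sym (negPf k0).
by rewrite mul0r.
Qed.
Definition Pn (n : nat) : {group {'GL_n[F]}} := group (Pn_group_set n).

Fact Tn_group_set n : group_set (Tn_set n).
Proof.
apply/group_setP; split=> [|g h].
  rewrite inE; apply/andP; split; first by apply/forallP=> j; rewrite GL_1E mxE.
  by do 2!apply/forallP=> ?; apply/implyP=> _; rewrite GL_1E mxE.
rewrite !inE => /andP[/forallP g0 /forallP g1] /andP[/forallP h0 /forallP h1].
apply/andP; split.
  apply/forallP => i; rewrite GL_ME mxE (bigD1 0) //= (eqP (h0 0)) mulr1.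
  rewrite (eqP (g0 i)) big1 ?addr0 // => k k0.
  by rewrite (eqP (h0 k)) (negPf k0) mulr0.
apply/forallP=> i; apply/forallP=> j; apply/implyP=> i1.
have gi k : GLval g i k = (i == k)%:R.
  by have /forallP/(_ k)/implyP/(_ i1)/eqP := g1 i.
have hi k : GLval h i k = (i == k)%:R.
  by have /forallP/(_ k)/implyP/(_ i1)/eqP := h1 i.
rewrite GL_ME mxE (bigD1 i) //= gi eqxx mul1r hi big1 ?addr0 // => k ki.
by rewrite gi eq_sym (negPf ki) mul0r.
Qed.
Definition Tn (n : nat) : {group {'GL_n[F]}} := group (Tn_group_set n).

Definition upper_unip (m : nat) : {set {'GL_m.+1[F]}} :=
  [set g : {'GL_m.+1[F]} | [exists w : 'rV[F]_m, GLval g == block_mx 1%:M w 0 1%:M]].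

Definition lower_unip (m : nat) : {set {'GL_m.+1[F]}} :=
  [set g : {'GL_m.+1[F]} | [exists v : 'cV[F]_m, GLval g == block_mx 1%:M 0 v 1%:M]].

(* [lift0_mx A] is the block matrix [1, 0; 0, A]. *)
Definition lift_Pn (m : nat) : {set {'GL_m.+2[F]}} :=
  [set g : {'GL_m.+2[F]} |
    [exists Z in Pn m.+1, GLval g == lift0_mx (GLval Z)]].

(* Quantifying over invertible ['M_m] rather than ['GL_m[F]] keeps m = 0 correct. *)
Definition lift_GLn (m : nat) : {set {'GL_m.+1[F]}} :=
  [set g : {'GL_m.+1[F]} | [exists A : 'M[F]_m,
              (A \in unitmx) && (GLval g == lift0_mx A)]].

End MatrixGroups.

(* Main.v *)
Require Import Defs.
From HB Require Import structures.
From mathcomp Require Import all_boot all_order all_algebra all_fingroup.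
From mathcomp Require Import all_solvable all_field all_character.

Set Implicit Arguments.
Unset Strict Implicit.
Unset Printing Implicit Defensive.

Import GRing.Theory.
Local Open Scope ring_scope.

(** Wigner-Mackey method of little groups.  In [T_n], the abelian normal
    subgroup [N] of row vectors [w] has characters [w |-> psi (w *m u)], for
    [psi] a fixed nontrivial additive character and [u] a column vector, and
    [Z] in [P_(n-1)] sends the character of [u] to that of [Z *m u].  The
    irreducible characters of [T_n] over an orbit are obtained by extending a
    character of the orbit to its stabilizer, twisting by the irreducible
    characters of the stabilizer in [P_(n-1)] (Gallagher), and inducing
    (Clifford); so the orbit of [u] contributes the zeta polynomial of the
    stabilizer at ['X^(size of the orbit)].  As [P_(n-1)] fixes the first
    entry [a] of [u], its orbits are: one of size [q^(n-2)] for each [a != 0],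
    with stabilizer [GL_(n-2)]; the nonzero [u] with [a = 0], with stabilizer
    isomorphic to [T_(n-1)]; and the fixed point [0]. *)

(** * The method of little groups *)

(** Degrees are natural numbers while character values lie in [algC]; this carries relations between
    values at 1 over to exponents of ['X]. *)
Lemma irr_degreeM (gT hT : finGroupType) (G : {group gT}) (H : {group hT})
    (i : Iirr G) (j : Iirr H) (n : nat) :
  'chi_i 1%g = n%:R * 'chi_j 1%g ->
  irr_degree (socle_of_Iirr i) = (n * irr_degree (socle_of_Iirr j))%N.
Proof. by rewrite !irr1_degree -natrM => /eqP; rewrite Num.Theory.eqr_nat => /eqP. Qed.

Lemma rep_zeta_isog (gT hT : finGroupType) (G : {group gT}) (H : {group hT}) :
  G \isog H -> rep_zeta G = rep_zeta H.
Proof.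
case/isogP=> f injf fG; have isoGH : isom G H f by apply/isomP.
rewrite /rep_zeta (reindex (isom_Iirr isoGH)) /=; last first.
  exists (isom_Iirr (isom_sym isoGH)) => i _; first exact: isom_IirrK.
  exact: isom_IirrKV.
apply: eq_bigr => i _; congr 'X^_; apply/esym.
by rewrite (@irr_degreeM _ _ _ _ _ i 1) ?mul1n // mul1r isom_IirrE cfIsom1.
Qed.

Lemma rep_zeta_abelian (gT : finGroupType) (G : {group gT}) :
  abelian G -> rep_zeta G = #|G|%:R * 'X.
Proof.
move=> abG; rewrite /rep_zeta (eq_bigr (fun _ => 'X)) => [|i _].
  by rewrite sumr_const card_Iirr_abelian // mulr_natl.
have /char_abelianP/(_ i)/andP[_ /eqP] := abG.
rewrite irr1_degree => /eqP; rewrite -[1]/(1%:R) Num.Theory.eqr_nat => /eqP->.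
by rewrite expr1.
Qed.

(** Such an [f] is a representation by 1x1 matrices, so its character is linear, hence
    irreducible. *)
Lemma irr_of_morphism (gT : finGroupType) (G : {group gT}) (f : gT -> algC) :
    f 1%g = 1 -> {in G &, {morph f : x y / (x * y)%g >-> x * y}} ->
  exists i : Iirr G, {in G, 'chi_i =1 f}.
Proof.
move=> f1 fM; have fr : mx_repr G (fun x => (f x)%:M : 'M_1).
  split=> [|x y Gx Gy]; first by rewrite f1.
  by rewrite fM // scalar_mxM.
pose rG := MxRepresentation fr.
have lin : cfRepr rG \is a linear_char.
  by rewrite qualifE/= cfRepr_char cfRepr1 eqxx.
exists (cfIirr (cfRepr rG)) => x Gx; rewrite cfIirrE ?lin_char_irr //.
by rewrite cfunE Gx mulr1n /= mxtrace_scalar.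
Qed.

Section LittleGroups.

Variables (gT : finGroupType) (G N H : {group gT}).
Hypothesis defG : (N ><| H = G)%g.

(** The extension sends [n * k] to the value of ['chi_t] at [n], read off by [divgr N K]; it is
    multiplicative because [K] fixes ['chi_t]. *)
Lemma sdprod_irr_extend (T K : {group gT}) (t : Iirr N) :
    (N ><| K = T)%g -> 'chi_t \is a linear_char -> T \subset 'I['chi_t]%g ->
  exists c : Iirr T, 'Res[N] 'chi_c = 'chi_t.
Proof.
case/sdprod_context=> nsNT sKT NKT nNK tiNK lint inv.
have [c chic] : exists c : Iirr T,
    {in T, 'chi_c =1 fun x => 'chi_t (divgr N K x)}.
  apply: irr_of_morphism => [|x y].
    by rewrite -[X in divgr _ _ X]mulg1 divgrMid // lin_char1.
  rewrite -NKT => /mulsgP[n1 k1 Nn1 Kk1 ->] /mulsgP[n2 k2 Nn2 Kk2 ->].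
  have Nn2' : (n2 ^ k1^-1)%g \in N by rewrite memJ_norm // groupV (subsetP nNK).
  (* Moving [k1] past [n2] exhibits the [N]-part of the product. *)
  have -> : (n1 * k1 * (n2 * k2) = (n1 * n2 ^ k1^-1) * (k1 * k2))%g.
    by rewrite conjgE invgK !mulgA mulgKV.
  have Ik1 : k1^-1%g \in 'I['chi_t]%g by rewrite groupV (subsetP inv) ?(subsetP sKT).
  rewrite !divgrMid //; [|exact: groupM|exact: groupM].
  by rewrite (lin_charM lint) ?inertia_valJ.
exists c; apply/cfun_inP=> n Nn; have Tn := subsetP (normal_sub nsNT) n Nn.
rewrite cfResE ?(normal_sub nsNT) // chic //.
by rewrite -[X in divgr _ _ X]mulg1 divgrMid.
Qed.

(** Clifford: induction from the inertia group [T] is a bijection between the irreducible characters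
    of [T] and of [G] over ['chi_t]. Gallagher: those of [T] are the products of the extension [c]
    with the characters of [T / N], a group isomorphic to [K]. As [c] is linear, degrees are
    multiplied by the index of [T] only. *)
Lemma zeta_over_irr (K : {group gT}) (t : Iirr N) :
    'chi_t \is a linear_char -> (N ><| K = 'I_G['chi_t])%g ->
  \sum_(i in irr_constt ('Ind[G] 'chi_t)) 'X^(irr_degree (socle_of_Iirr i))
    = rep_zeta K \Po 'X^(#|G : 'I_G['chi_t]|%g) :> {poly int}.
Proof.
move=> lint defT; have nsNG : (N <| G)%g by case/sdprod_context: defG.
set T := 'I_G['chi_t]%G in defT *.
have [c resc] : exists c : Iirr T, 'Res[N] 'chi_c = 'chi_t.
  by apply: (sdprod_irr_extend defT) => //; apply: subsetIr.
have nsNT : (N <| T)%g by case/sdprod_context: defT.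
have [_ injB imB _ _] := constt_Inertia_bijection t nsNG.
have [irrM injM imM _] := constt_Ind_ext nsNT resc.
rewrite (eq_bigl _ _ (fun i => esym (imB i))) big_imset //=.
have -> : rep_zeta K = rep_zeta (T / N)%G by apply/rep_zeta_isog/(sdprod_isog defT).
rewrite [in RHS]/rep_zeta raddf_sum /=.
have imM' i : (i \in irr_constt ('Ind[T] 'chi_t))
    = (i \in [set mul_mod_Iirr c b | b in [set: Iirr (T / N)]]).
  rewrite imM; apply/codomP/imsetP => [[b ->]|[b _ ->]]; last by exists b.
  by exists b; rewrite ?inE.
rewrite (eq_bigl _ _ imM') big_imset /=; last by move=> b1 b2 _ _; apply: injM.
apply: eq_big => [b|b _]; first by rewrite inE.
rewrite comp_Xn_poly -exprM; congr 'X^_; apply: irr_degreeM.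
have sTG : T \subset G by apply: subsetIl.
rewrite cfIirrE; last first.
  by have [-> //] := constt_Inertia_bijection t nsNG; rewrite imM' imset_f.
rewrite cfInd1 // cfIirrE // cfunE mod_IirrE // cfMod1.
by rewrite -[X in _ * (_ * X)](cfRes1 N) resc lin_char1 // mulr1.
Qed.

(* [U] indexes the characters [lam u] of [N], [R] selects one index in each
   [H]-orbit, and [S r] is the stabilizer of [r] in [H].  That [act] is an
   action of [H] follows from [lamJ] and [lam_inj]. *)
Variables (U : finType) (lam : U -> gT -> algC) (act : gT -> U -> U).
Variables (R : {set U}) (S : U -> {group gT}).
Hypothesis lam1 : forall u, lam u 1%g = 1.
Hypothesis lamM : forall u, {in N &, {morph lam u : x y / (x * y)%g >-> x * y}}.
Hypothesis lam_inj : forall u v, {in N, lam u =1 lam v} -> u = v.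
Hypothesis cardU : #|U| = #|N|.
Hypothesis lamJ :
  forall u, {in H & N, forall h x, lam (act h u) x = lam u (x ^ h)%g}.
Hypothesis Rtrans : forall u, exists2 r, r \in R & exists2 h, h \in H & u = act h r.
Hypothesis Rinj : {in R & R & H, forall r s h, s = act h r -> r = s}.
Hypothesis stab : {in R, forall r, (S r : {set gT}) = [set h in H | act h r == r]}.

(** Every irreducible character of [G] lies over exactly one [G]-class of characters of [N], and
    these classes correspond to the [H]-orbits on [U], so the sum splits along [R]. *)
Theorem rep_zeta_little_groups : abelian N ->
  rep_zeta G =
    \sum_(r in R) (rep_zeta (S r) \Po 'X^#|[set act h r | h in H]|).
Proof.
move=> abN; have [nsNG sHG NHG nNH tiNH] := sdprod_context defG.
have sNG := normal_sub nsNG.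
have [f chif] : exists f : U -> Iirr N, forall u, {in N, 'chi_(f u) =1 lam u}.
  apply: (fin_all_exists (P := fun u i => {in N, 'chi_i =1 lam u})) => u.
  exact: irr_of_morphism (@lamM u).
have f_inj : injective f.
  by move=> u v fuv; apply: lam_inj => x Nx; rewrite -!chif ?fuv.
(* An abelian [N] has as many irreducible characters as elements, so the injection [f] exhausts
   them. *)
have [g fK gK] : bijective f.
  by apply: inj_card_bij => //; rewrite cardU card_Iirr_abelian.
have lin u : 'chi_(f u) \is a linear_char by move/char_abelianP: abN.
(* The inverse appears because [act] is a left action and conjugation of characters a right one. *)
have chiJ h u : h \in H -> 'chi_(f (act h u)) = ('chi_(f u) ^ h^-1)%CF.
  move=> Hh; have nNh := subsetP nNH h Hh.
  apply/cfun_inP=> x Nx; rewrite cfConjgE ?groupV // invgK.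
  by rewrite !chif ?memJ_norm // lamJ.
have classE u v : reflect (exists2 h, h \in H & v = act h u)
                          ('chi_(f v) \in ('chi_(f u) ^: G)%CF).
  apply: (iffP (cfclassP _ _ _)) => [[x Gx]|[h Hh ->]]; last first.
    by exists h^-1%g; rewrite ?chiJ // groupV (subsetP sHG).
  move: Gx; rewrite -NHG => /mulsgP[n h Nn Hh ->] Ev.
  (* The factor [n] fixes every character of [N], so only [h] counts. *)
  exists h^-1%g; first by rewrite groupV.
  apply/f_inj/irr_inj; rewrite chiJ ?groupV // invgK Ev.
  by rewrite (cfConjgM _ nsNG) ?(subsetP sNG n) ?(subsetP sHG h) // (cfConjg_id _ Nn).
have constE i u : (i \in irr_constt ('Ind[G] 'chi_(f u)))
    = (f u \in irr_constt ('Res[N] 'chi_i)) by apply: constt_Ind_Res.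
(* [p i] represents the orbit below ['chi_i]; conjugate characters of [N] induce the same character
   of [G]. *)
have [p pP] : exists p : Iirr G -> U, forall i,
    p i \in R /\ i \in irr_constt ('Ind[G] 'chi_(f (p i))).
  apply: (fin_all_exists
    (P := fun i r => r \in R /\ i \in irr_constt ('Ind[G] 'chi_(f r)))) => i.
  have [t it] := constt_cfRes_irr N i.
  have [r Rr [h Hh Et]] := Rtrans (g t); exists r; split=> //.
  rewrite (@cfclass_Ind _ _ _ _ 'chi_t) ?constt_Ind_Res // -(gK t).
  by apply/classE; exists h.
rewrite {1}/rep_zeta (partition_big p (mem R)) => [|i _] /=; last by case: (pP i).
apply: eq_bigr => r Rr.
(* Both sides count the [G]-class of ['chi_(f r)]. *)
have -> : #|[set act h r | h in H]| = #|G : 'I_G['chi_(f r)]|%g.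
  rewrite -card_cfclass_Iirr // -(card_imset _ f_inj); apply: eq_card => i.
  rewrite cfclass_IirrE -(gK i); apply/imsetP/classE.
    by case=> u /imsetP[h Hh ->] /f_inj ->; exists h.
  by case=> h Hh ->; exists (act h r); rewrite ?imset_f.
rewrite -zeta_over_irr //; last first.
  have -> : 'I_G['chi_(f r)]%g = (N * S r)%g.
    (* Dedekind's modular law: the inertia group contains [N], so it is [N] times its intersection
       with [H]. *)
    rewrite -{1}NHG -group_modl ?sub_inertia //; congr (_ * _)%g.
    rewrite stab //; apply/setP=> h; rewrite in_setI [h \in 'I[_]%g]inE [in RHS]inE.
    case Hh: (h \in H); rewrite ?andbF //= (subsetP nNH) //=.
    rewrite -(inj_eq f_inj) -(inj_eq irr_inj) chiJ //.
    by apply/eqP/eqP=> E; rewrite -{1}E ?cfConjgK ?cfConjgKV.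
  have sSH : S r \subset H by rewrite stab //; apply/subsetP=> h /setIdP[].
  apply: sdprodE; first exact: subset_trans nNH.
  by apply/trivgP; rewrite -tiNH setIS.
apply: eq_bigl => i; have [Rp ip] := pP i; apply/eqP/idP=> [<- //|ir].
(* Restricted to [N], ['chi_i] is a multiple of the sum over the class of ['chi_(f (p i))]; by
   orthogonality, a constituent ['chi_(f r)] lies in that class. *)
move: ip ir; rewrite !constE => /(Clifford_Res_sum_cfclass nsNG) Ei ir.
have: 'chi_(f r) \in ('chi_(f (p i)) ^: G)%CF.
  apply: contraTT ir => nir; rewrite inE Ei cfdotZl cfdot_suml.
  rewrite big_seq big1 ?mulr0 ?eqxx //.
  move=> xi /cfclassP[y Gy Exi]; rewrite Exi -conjg_IirrE cfdot_irr.
  case: eqP => // Er; case/cfclassP: nir; exists y => //.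
  by rewrite -Er conjg_IirrE.
case/classE=> h Hh Er; exact: Rinj Hh Er.
Qed.

End LittleGroups.

(** * Block decompositions of T_n and P_n *)

Section BlockGroups.

Variable F : finFieldType.

(** The default value 1 at singular [A] makes this total, so that elements can be built before
    invertibility is proved. *)
Definition GL_of n (A : 'M[F]_n.+1) : {'GL_n.+1[F]} :=
  insubd (1%g : {'GL_n.+1[F]}) A.

Lemma GL_ofK n (A : 'M[F]_n.+1) : A \in unitmx -> GLval (GL_of A) = A.
Proof. by move=> uA; exact: (insubdK (1%g : {'GL_n.+1[F]}) uA). Qed.

Lemma GLval_inj n : injective (@GLval n F).
Proof. exact: val_inj. Qed.

Lemma GLval_unitmx n (g : {'GL_n.+1[F]}) : (GLval g : 'M_n.+1) \in unitmx.
Proof. exact: (@GL_unitmx n.+1 _ g). Qed.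

Definition upper_elt m (w : 'rV[F]_m) : {'GL_m.+1[F]} :=
  GL_of (block_mx 1%:M w 0 1%:M : 'M_(1 + m)).

Definition lower_elt m (v : 'cV[F]_m) : {'GL_m.+1[F]} :=
  GL_of (block_mx 1%:M 0 v 1%:M : 'M_(1 + m)).

Definition lift_elt m (Z : {'GL_m.+1[F]}) : {'GL_m.+2[F]} :=
  GL_of (lift0_mx (GLval Z)).

Lemma upper_eltE m (w : 'rV[F]_m) :
  GLval (upper_elt w) = block_mx 1%:M w 0 1%:M :> 'M_(1 + m).
Proof. by rewrite GL_ofK // unitmxE (@det_ublock _ 1 m) !det1 mulr1 unitr1. Qed.

Lemma lower_eltE m (v : 'cV[F]_m) :
  GLval (lower_elt v) = block_mx 1%:M 0 v 1%:M :> 'M_(1 + m).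
Proof. by rewrite GL_ofK // unitmxE (@det_lblock _ 1 m) !det1 mulr1 unitr1. Qed.

Lemma lift_eltE m (Z : {'GL_m.+1[F]}) :
  GLval (lift_elt Z) = lift0_mx (GLval Z).
Proof. rewrite GL_ofK // unitmxE (@det_ublock _ 1 m.+1) det1 mul1r.
by have := GLval_unitmx Z; rewrite unitmxE.
Qed.

(** Between vectors, [*] is addition, the group law of the finite group of row vectors. *)
Lemma upper_eltM m : {morph @upper_elt m : w w' / (w * w')%g >-> (w * w')%g}.
Proof.
move=> w w'; apply: GLval_inj; rewrite GL_MxE !upper_eltE.
rewrite (@mulmx_block _ 1 m 1 m 1 m) !(mulmx1, mul1mx, mulmx0, mul0mx, addr0, add0r).
by rewrite addrC.
Qed.
Canonical upper_morphism m := Morphism (D := setT) (in2W (@upper_eltM m)).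

Lemma lower_eltM m : {morph @lower_elt m : v v' / (v * v')%g >-> (v * v')%g}.
Proof.
move=> v v'; apply: GLval_inj; rewrite GL_MxE !lower_eltE.
by rewrite (@mulmx_block _ 1 m 1 m 1 m) !(mulmx1, mul1mx, mulmx0, mul0mx, addr0, add0r).
Qed.
Canonical lower_morphism m := Morphism (D := setT) (in2W (@lower_eltM m)).

Lemma lift_eltM m : {morph @lift_elt m : Z Z' / (Z * Z')%g >-> (Z * Z')%g}.
Proof.
move=> Z Z'; apply: GLval_inj; rewrite GL_MxE !lift_eltE GL_MxE.
by rewrite (@mulmx_block _ 1 m.+1 1 m.+1 1 m.+1) !(mulmx1, mul1mx, mulmx0, mul0mx, addr0, add0r).
Qed.
Canonical lift_morphism m := Morphism (D := setT) (in2W (@lift_eltM m)).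

Lemma upper_elt_inj m : injective (@upper_elt m).
Proof.
by move=> w w' /(congr1 (@GLval _ _)); rewrite !upper_eltE => /(@eq_block_mx _ 1 m 1 m)[].
Qed.

Lemma lower_elt_inj m : injective (@lower_elt m).
Proof.
by move=> v v' /(congr1 (@GLval _ _)); rewrite !lower_eltE => /(@eq_block_mx _ 1 m 1 m)[].
Qed.

Lemma lift_elt_inj m : injective (@lift_elt m).
Proof.
move=> Z Z' /(congr1 (@GLval _ _)); rewrite !lift_eltE => /(@eq_block_mx _ 1 m.+1 1 m.+1)[_ _ _].
exact: (@GLval_inj m.+1).
Qed.

Lemma upper_unipE m : upper_unip F m = (upper_morphism m @* setT)%g.
Proof.
apply/setP=> g; rewrite inE; apply/existsP/morphimP => [[w /eqP gE]|[w _ _ ->]].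
  by exists w; rewrite ?inE //; apply: GLval_inj; rewrite /= upper_eltE.
by exists w; rewrite /= upper_eltE.
Qed.

Lemma lower_unipE m : lower_unip F m = (lower_morphism m @* setT)%g.
Proof.
apply/setP=> g; rewrite inE; apply/existsP/morphimP => [[v /eqP gE]|[v _ _ ->]].
  by exists v; rewrite ?inE //; apply: GLval_inj; rewrite /= lower_eltE.
by exists v; rewrite /= lower_eltE.
Qed.

Lemma lift_PnE m : lift_Pn F m = (lift_morphism m @* Pn F m.+1)%g.
Proof.
apply/setP=> g; rewrite inE.
apply/existsP/morphimP => [[Z /andP[PZ /eqP gE]]|[Z _ PZ ->]].
  by exists Z => //; apply: GLval_inj; rewrite /= lift_eltE.
by exists Z; rewrite /= lift_eltE PZ eqxx.
Qed.

Lemma lift_GLnE m : lift_GLn F m.+1 = (lift_morphism m @* 'GL_m.+1[F])%g.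
Proof.
apply/setP=> g; rewrite inE.
apply/existsP/morphimP => [[A /andP[uA /eqP gE]]|[Z _ _ ->]].
  by exists (GL_of A); rewrite ?inE //; apply: GLval_inj; rewrite /= lift_eltE GL_ofK.
by exists (GLval Z); rewrite /= lift_eltE GLval_unitmx eqxx.
Qed.

(** There is only one 0x0 matrix. This size stands apart because [lift_elt] starts from
    [{'GL_m.+1[F]}]. *)
Lemma lift_GLn0E : lift_GLn F 0 = 1%g.
Proof.
have lift1 (A : 'M[F]_0) : lift0_mx A = 1%:M.
  by rewrite (scalar_mx_block 1 0) /lift0_mx; congr block_mx; rewrite [LHS]flatmx0 [RHS]flatmx0.
apply/setP=> g; rewrite inE; apply/existsP/set1P => [[A /andP[_ /eqP gE]]|->].
  by apply: GLval_inj; rewrite gE lift1.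
by exists 1%:M; rewrite unitmx1 lift1 /=.
Qed.

(** * Membership in [Pn] and [Tn] through blocks, and the semidirect products *)

Lemma block_mx10_row0 m (v : 'cV[F]_m) (A : 'M_m) (j : 'I_m.+1) :
  (block_mx 1%:M 0 v A : 'M_(1 + m)) 0 j = (0 == j)%:R.
Proof.
have -> : 0 = lshift m 0 :> 'I_(1 + m) by apply: val_inj.
case: (@split_ordP 1 m j) => k ->.
  by rewrite (@block_mxEul _ 1 m 1 m) ord1 mxE !eqxx.
by rewrite (@block_mxEur _ 1 m 1 m) mxE.
Qed.

Lemma block_mx10_col0 m (w : 'rV[F]_m) (A : 'M_m) (i : 'I_m.+1) :
  (block_mx 1%:M w 0 A : 'M_(1 + m)) i 0 = (i == 0)%:R.
Proof.
have -> : 0 = lshift m 0 :> 'I_(1 + m) by apply: val_inj.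
case: (@split_ordP 1 m i) => k ->.
  by rewrite (@block_mxEul _ 1 m 1 m) !ord1 mxE !eqxx.
by rewrite (@block_mxEdl _ 1 m 1 m) mxE.
Qed.

Lemma block_mx10_row1 m (w : 'rV[F]_m.+1) (A : 'M_m.+1) (j : 'I_(1 + m.+1)) :
    (forall k, A 0 k = (0 == k)%:R) ->
  (block_mx 1%:M w 0 A : 'M_(1 + m.+1)) (rshift 1 0) j = (rshift 1 0 == j)%:R.
Proof.
move=> A0; case: (split_ordP j) => k ->.
  by rewrite (@block_mxEdl _ 1 m.+1 1 m.+1) eq_rlshift mxE.
by rewrite (@block_mxEdr _ 1 m.+1 1 m.+1) eq_rshift A0.
Qed.

Lemma PnP m (g : {'GL_m.+1[F]}) :
  reflect (exists v, exists2 A, A \in unitmx & GLval g = block_mx 1%:M 0 v A :> 'M_(1 + m))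
          (g \in Pn F m.+1).
Proof.
rewrite inE; apply: (iffP forallP) => [gP|[v [A _ gE]] j]; last first.
  by rewrite gE; apply/eqP; apply: block_mx10_row0.
have gE : GLval g = block_mx 1%:M 0 (@dlsubmx _ 1 m 1 m (GLval g))
                                    (@drsubmx _ 1 m 1 m (GLval g)) :> 'M_(1 + m).
  rewrite -[LHS](@submxK _ 1 m 1 m); congr block_mx; apply/matrixP=> i j.
    by rewrite !ord1 !mxE lshift0 (eqP (gP _)).
  by rewrite !ord1 !mxE lshift0 (eqP (gP _)).
exists (@dlsubmx _ 1 m 1 m (GLval g)), (@drsubmx _ 1 m 1 m (GLval g)) => //.
by have := GLval_unitmx g; rewrite {1}gE !unitmxE (@det_lblock _ 1 m) det1 mul1r.
Qed.

(** The second row of [g] without its first entry is the first row of the lower right block, which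
    is why that block lies in [Pn]. *)
Lemma TnP m (g : {'GL_m.+2[F]}) :
  reflect (exists w, exists2 Z, Z \in Pn F m.+1
             & GLval g = block_mx 1%:M w 0 (GLval Z) :> 'M_(1 + m.+1))
          (g \in Tn F m.+2).
Proof.
rewrite inE; apply: (iffP andP) => [[/forallP gc /forallP gr]|[w [Z PZ gE]]]; last first.
  split; apply/forallP => i; rewrite gE.
    by apply/eqP; apply: block_mx10_col0.
  apply/forallP=> j; apply/implyP=> /eqP i1.
  have -> : i = rshift 1 0 by apply: val_inj; rewrite i1.
  apply/eqP; apply: block_mx10_row1 => k.
  by move: PZ; rewrite inE => /forallP/(_ k)/eqP.
pose Z := @drsubmx _ 1 m.+1 1 m.+1 (GLval g).
have gE : GLval g = block_mx 1%:M (@ursubmx _ 1 m.+1 1 m.+1 (GLval g)) 0 Z :> 'M_(1 + m.+1).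
  rewrite -[LHS](@submxK _ 1 m.+1 1 m.+1); congr block_mx; apply/matrixP=> i j.
    by rewrite !ord1 !mxE lshift0 (eqP (gc _)).
  by rewrite !ord1 !mxE lshift0 (eqP (gc _)).
have uZ : Z \in unitmx.
  by have := GLval_unitmx g; rewrite gE !unitmxE (@det_ublock _ 1 m.+1) det1 mul1r.
exists (@ursubmx _ 1 m.+1 1 m.+1 (GLval g)), (GL_of Z); rewrite ?GL_ofK //.
rewrite inE; apply/forallP=> j; rewrite GL_ofK // !mxE.
have /forallP/(_ (rshift 1 j))/implyP/(_ isT)/eqP-> := gr (rshift 1 0).
apply/eqP; congr (nat_of_bool _)%:R; exact: eq_rshift.
Qed.

(** On the character [psi (w *m u)] this action becomes left multiplication of [u] by [Z]. *)
Lemma conjg_upper_lift m (w : 'rV[F]_m.+1) (Z : {'GL_m.+1[F]}) :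
  (upper_elt w ^ lift_elt Z)%g = upper_elt (w *m GLval Z).
Proof.
(* Multiplying by [lift_elt Z] on the left avoids inverting a block matrix. *)
apply: (mulgI (lift_elt Z)); rewrite -conjgC; apply: GLval_inj.
rewrite !GL_MxE !upper_eltE !lift_eltE !(@mulmx_block _ 1 m.+1 1 m.+1 1 m.+1).
by rewrite !(mulmx1, mul1mx, mulmx0, mul0mx, addr0, add0r).
Qed.

Lemma conjg_lower_lift m (v : 'cV[F]_m.+1) (Z : {'GL_m.+1[F]}) :
  (lower_elt v ^ lift_elt Z)%g = lower_elt (invmx (GLval Z) *m v).
Proof.
apply: (mulgI (lift_elt Z)); rewrite -conjgC; apply: GLval_inj.
rewrite !GL_MxE !lower_eltE !lift_eltE !(@mulmx_block _ 1 m.+1 1 m.+1 1 m.+1).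
by rewrite !(mulmx1, mul1mx, mulmx0, mul0mx, addr0, add0r) mulKVmx // GLval_unitmx.
Qed.

Lemma sdprod_Tn m : (upper_unip F m.+1 ><| lift_Pn F m)%g = Tn F m.+2.
Proof.
rewrite upper_unipE lift_PnE sdprodE; first last.
- apply/trivgP/subsetP=> g /setIP[/morphimP[w _ _ ->] /morphimP[Z _ _ /=]].
  move/(congr1 (@GLval _ _)); rewrite upper_eltE lift_eltE.
  move=> /(@eq_block_mx _ 1 m.+1 1 m.+1)[_ -> _ _].
  by rewrite -[0]/(1%g) (morph1 (upper_morphism _)) set11.
- apply/subsetP=> _ /morphimP[Z _ _ ->]; rewrite inE.
  apply/subsetP=> _ /imsetP[_ /morphimP[w _ _ ->] ->].
  by rewrite /= conjg_upper_lift (mem_morphim (upper_morphism _)) ?inE.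
apply/setP=> g; apply/mulsgP/TnP.
  case=> _ _ /morphimP[w _ _ ->] /morphimP[Z _ PZ ->] ->.
  exists (w *m GLval Z); exists Z => //.
  rewrite GL_MxE upper_eltE lift_eltE (@mulmx_block _ 1 m.+1 1 m.+1 1 m.+1).
  by rewrite !(mulmx1, mul1mx, mulmx0, mul0mx, addr0, add0r).
(* The product of [upper_elt w'] and [lift_elt Z] has upper right block [w' *m Z], whence the
   inverse in the witness. *)
case=> w [Z PZ gE]; exists (upper_elt (w *m invmx (GLval Z))) (lift_elt Z).
- by rewrite (mem_morphim (upper_morphism _)) ?inE.
- by rewrite (mem_morphim (lift_morphism _)) ?in_setT.
apply: GLval_inj; rewrite GL_MxE upper_eltE lift_eltE gE.
rewrite (@mulmx_block _ 1 m.+1 1 m.+1 1 m.+1) mulmxKV ?GLval_unitmx //.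
by rewrite !(mulmx1, mul1mx, mulmx0, mul0mx, addr0, add0r).
Qed.

Lemma sdprod_Pn m : (lower_unip F m ><| lift_GLn F m)%g = Pn F m.+1.
Proof.
case: m => [|m].
  rewrite lift_GLn0E sdprodg1 lower_unipE; apply/setP=> g.
  apply/morphimP/PnP=> [[v _ _ ->]|[v [A _ gE]]].
    by exists v, 1%:M; rewrite ?unitmx1 //= lower_eltE.
  have A1 : A = 1%:M by rewrite [LHS]flatmx0 [RHS]flatmx0.
  by exists v; rewrite ?inE //; apply: GLval_inj; rewrite /= lower_eltE gE A1.
rewrite lower_unipE lift_GLnE sdprodE; first last.
- apply/trivgP/subsetP=> g /setIP[/morphimP[v _ _ ->] /morphimP[Z _ _ /=]].
  move/(congr1 (@GLval _ _)); rewrite lower_eltE lift_eltE.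
  move=> /(@eq_block_mx _ 1 m.+1 1 m.+1)[_ _ -> _].
  by rewrite -[0]/(1%g) (morph1 (lower_morphism _)) set11.
- apply/subsetP=> _ /morphimP[Z _ _ ->]; rewrite inE.
  apply/subsetP=> _ /imsetP[_ /morphimP[v _ _ ->] ->].
  by rewrite /= conjg_lower_lift (mem_morphim (lower_morphism _)) ?inE.
apply/setP=> g; apply/mulsgP/PnP.
  case=> _ _ /morphimP[v _ _ ->] /morphimP[Z _ PZ ->] ->.
  exists v; exists (GLval Z); first exact: GLval_unitmx.
  rewrite GL_MxE lower_eltE lift_eltE (@mulmx_block _ 1 m.+1 1 m.+1 1 m.+1).
  by rewrite !(mulmx1, mul1mx, mulmx0, mul0mx, addr0, add0r).
case=> v [A uA gE]; exists (lower_elt v) (lift_elt (GL_of A)).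
- by rewrite (mem_morphim (lower_morphism _)) ?inE.
- by rewrite (mem_morphim (lift_morphism _)) ?in_setT.
apply: GLval_inj; rewrite GL_MxE lower_eltE lift_eltE gE GL_ofK //.
rewrite (@mulmx_block _ 1 m.+1 1 m.+1 1 m.+1).
by rewrite !(mulmx1, mul1mx, mulmx0, mul0mx, addr0, add0r).
Qed.

Lemma injm_lift m : ('injm (lift_morphism m))%g.
Proof. by apply/injmP=> Z Z' _ _; apply: lift_elt_inj. Qed.

Lemma lift_isog m (K : {group {'GL_m.+1[F]}}) : K \isog (lift_morphism m @* K)%g.
Proof. by apply: sub_isog; [apply: subsetT | apply: injm_lift]. Qed.

Lemma upper_unip_isog m : [set: 'rV[F]_m] \isog upper_unip F m.
Proof.
rewrite upper_unipE; apply: sub_isog; first exact: subsetT.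
by apply/injmP=> w w' _ _; apply: upper_elt_inj.
Qed.

Lemma lower_unip_isog m : [set: 'cV[F]_m] \isog lower_unip F m.
Proof.
rewrite lower_unipE; apply: sub_isog; first exact: subsetT.
by apply/injmP=> w w' _ _; apply: lower_elt_inj.
Qed.

Lemma GLn_isog m : GLn F m \isog lift_GLn F m.
Proof.
case: m => [|m]; last by rewrite lift_GLnE lift_isog.
by rewrite lift_GLn0E; apply: trivial_isog.
Qed.

End BlockGroups.

(** * Orbits and stabilizers of P_n on column vectors *)

(** An abelian group of order [#|F| > 1] has a nonprincipal irreducible character, and it is linear.
    With 1x1 matrices as scalars, [psi] applies directly to [w *m u]. *)
Lemma nontrivial_additive_char (F : finFieldType) :
  exists2 psi : 'M[F]_1 -> algC,
    psi 0 = 1 /\ {morph psi : x y / x + y >-> x * y} & exists x, psi x != 1.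
Proof.
pose G := [set: 'M[F]_1]%G.
have abG : abelian G by apply/centsP=> x _ y _; apply: addrC.
have [i ni0] : exists i : Iirr G, i != 0.
  apply/existsP; rewrite -negb_forall; apply/negP=> /forallP i0.
  have: (1 < #|Iirr G|)%N.
    by rewrite card_Iirr_abelian // cardsT card_mx expn1 finNzRing_gt1.
  rewrite ltnNge => /negP[]; apply/card_le1P=> j _ k.
  by rewrite !inE (eqP (i0 j)) (eqP (i0 k)).
have lin : 'chi_i \is a linear_char by move/char_abelianP: abG.
exists 'chi_i.
  split=> [|x y]; first exact: lin_char1 lin.
  by rewrite -[x + y]/(x * y)%g (lin_charM lin) ?inE.
apply/existsP; rewrite -negb_forall; apply: contra ni0 => /forallP chi1.
rewrite -irr_eq1; apply/eqP/cfun_inP=> x Gx.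
by rewrite cfun1E Gx (eqP (chi1 x)).
Qed.

Section StabilizersAndOrbits.

Variable F : finFieldType.

Fact stab_col_group_set m (u : 'cV[F]_m.+1) :
  group_set [set g : {'GL_m.+1[F]} | GLval g *m u == u].
Proof.
apply/group_setP; split=> [|g h]; first by rewrite inE GL_1E mul1mx.
by rewrite !inE GL_MxE -mulmxA => /eqP gu /eqP->; rewrite gu.
Qed.
Canonical stab_col m (u : 'cV[F]_m.+1) := group (stab_col_group_set u).

Definition Pn_orbit m (u : 'cV[F]_m.+1) : {set 'cV[F]_m.+1} :=
  [set (GLval (Z : {'GL_m.+1[F]}) *m u : 'cV_m.+1) | Z in Pn F m.+1].

(** In the rank factorization of [b], of rank 1, the row factor is a 1x1 unit, which is absorbed as
    a scalar into the column factor. *)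
Lemma nonzero_col_transitive m (b : 'cV[F]_m.+1) :
  b != 0 -> exists2 A : 'M_m.+1, A \in unitmx & b = A *m delta_mx 0 0.
Proof.
move=> b0; have rb : \rank b = 1%N.
  by apply/eqP; rewrite eqn_leq rank_leq_col lt0n mxrank_eq0.
exists (row_ebase b 0 0 *: col_ebase b).
  rewrite unitmxZ ?col_ebase_unit //.
  by have := row_ebase_unit b; rewrite unitmxE det_mx11.
rewrite -[LHS]mulmx_ebase rb -scalemxAl [row_ebase b]mx11_scalar mul_mx_scalar.
rewrite !mxE eqxx mulr1n; congr (_ *: (_ *m _)).
by apply/matrixP=> i j; rewrite !mxE !ord1 andbT; case: i => -[|i].
Qed.

(* Exchanging the first two basis vectors turns the fixed first row and second
   column into a fixed second row and first column. *)
Lemma stab_col_Tn_isog m (u : 'cV_m.+2) :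
    u = delta_mx (lift ord0 ord0) 0 ->
  (Pn F m.+2 :&: stab_col u)%G \isog Tn F m.+2.
Proof.
set i1 := lift ord0 ord0; move=> ->.
set s := tperm ord0 i1 : 'S_m.+2.
pose p : {'GL_m.+2[F]} := GL_of (perm_mx s).
have pE : GLval p = perm_mx s by rewrite GL_ofK // unitmx_perm.
have pV : (p^-1 = p)%g.
  apply/eqP; rewrite eq_invg_mul; apply/eqP; apply: GLval_inj.
  by rewrite GL_MxE pE -perm_mxM tperm2 perm_mx1.
(* As [s] is an involution, conjugation by [p] applies [s] to both indices. *)
have pJ (g : {'GL_m.+2[F]}) i j : GLval (g ^ p)%g i j = GLval g (s i) (s j).
  rewrite conjgE pV !GL_MxE pE -[X in _ *m (_ *m perm_mx X)]tpermV.
  by rewrite -/s -col_permE -row_permE !mxE.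
have s0 : s ord0 = i1 by apply: tpermL.
have s1 : s i1 = ord0 by apply: tpermR.
have colE (g : {'GL_m.+2[F]}) i : (GLval g *m delta_mx i1 0 : 'cV_m.+2) i 0 = GLval g i i1.
  by rewrite -colE mxE.
have -> : Tn F m.+2 = ((Pn F m.+2 :&: stab_col (delta_mx i1 0)) :^ p)%G.
  apply: val_inj; apply/setP=> g /=; rewrite mem_conjg pV !inE.
  apply/andP/andP=> [[/forallP gc /forallP gr]|[/forallP gr /eqP/matrixP gc]].
    split.
      apply/forallP=> j; rewrite pJ s0.
      have /forallP/(_ (s j))/implyP/(_ isT)/eqP-> := gr i1.
      by rewrite -s0 (inj_eq perm_inj).
    apply/eqP/matrixP=> i j; rewrite !ord1 colE pJ s1 (eqP (gc _)) mxE andbT.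
    by rewrite -[i == i1](inj_eq (@perm_inj _ s)) s1.
  split; apply/forallP=> i.
    have := gc (s i) 0; rewrite colE pJ s1 tpermK mxE andbT => ->.
    by rewrite -s0 (inj_eq perm_inj).
  apply/forallP=> j; apply/implyP=> /eqP iE.
  have {iE} -> : i = i1 by apply: val_inj.
  have := gr (s j); rewrite pJ s0 tpermK => /eqP->.
  by rewrite -[i1 == j](inj_eq (@perm_inj _ s)) s1.
exact: conj_isog.
Qed.

(** Little groups for the characters [psi (w *m u)], with the choice of orbit representatives left
    open. *)
Lemma rep_zeta_Tn_orbits m (R : {set 'cV[F]_m.+1}) :
    (forall u, exists2 r, r \in R & exists2 Z, Z \in Pn F m.+1 & u = GLval Z *m r) ->
    {in R & R & Pn F m.+1, forall (r s : 'cV[F]_m.+1) (Z : {'GL_m.+1[F]}),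
       s = GLval Z *m r -> r = s} ->
  rep_zeta (Tn F m.+2) =
    \sum_(r in R) (rep_zeta (Pn F m.+1 :&: stab_col r)%G
                     \Po 'X^#|Pn_orbit r|).
Proof.
move=> Rtrans Rinj.
have [psi [psi0 psiD] [x psix]] := nontrivial_additive_char F.
(* [lam] and [act] must be defined on the whole matrix group, so [w] and [Z] are read off as blocks
   of an arbitrary matrix. *)
pose ur (g : {'GL_m.+2[F]}) := @ursubmx _ 1 m.+1 1 m.+1 (GLval g).
pose dr (g : {'GL_m.+2[F]}) := @drsubmx _ 1 m.+1 1 m.+1 (GLval g).
have urE w : ur (upper_elt w) = w by rewrite /ur upper_eltE block_mxKur.
have drE Z : dr (lift_elt Z) = GLval Z by rewrite /dr lift_eltE block_mxKdr.
pose lam (u : 'cV[F]_m.+1) g := psi (ur g *m u).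
pose act g (u : 'cV[F]_m.+1) := dr g *m u.
pose N := (upper_morphism F m.+1 @* setT)%G.
pose H := (lift_morphism F m @* Pn F m.+1)%G.
pose S u := (lift_morphism F m @* (Pn F m.+1 :&: stab_col u))%G.
have defT : (N ><| H = Tn F m.+2)%g.
  by rewrite -sdprod_Tn upper_unipE lift_PnE.
have liftP Z : (lift_elt Z \in H) = (Z \in Pn F m.+1).
  apply/morphimP/idP=> [[Z' _ PZ' /lift_elt_inj-> //]|PZ].
  by exists Z; rewrite ?in_setT.
rewrite (rep_zeta_little_groups defT (lam := lam) (act := act) (R := R) (S := S)).
- apply: eq_bigr => r _.
  rewrite -(rep_zeta_isog (lift_isog (Pn F m.+1 :&: stab_col r)%G)).
  congr (_ \Po 'X^_).
  apply: eq_card => u; apply/imsetP/imsetP=> [[_ /morphimP[Z _ PZ ->] ->]|[Z PZ ->]].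
    by exists Z; rewrite // /act drE.
  by exists (lift_elt Z); rewrite ?liftP // /act drE.
- move=> u; rewrite /lam -[1%g]/(1%g : {'GL_m.+2[F]}).
  rewrite -(morph1 (upper_morphism F m.+1)) /= urE mul0mx //.
- move=> u _ _ /morphimP[w _ _ ->] /morphimP[w' _ _ ->].
  by rewrite /lam -upper_eltM !urE mulmxDl psiD.
(* If [u] and [v] differ by [c] at entry [i], the row [w] with [x / c] at [i] gives
   [w *m (u - v) = x], where [psi] is not 1. *)
- move=> u v uv; apply/eqP; rewrite -subr_eq0; apply: contraNT psix => /cV0Pn[i].
  set c := (u - v) i 0 => c0; pose w : 'rV_m.+1 := x 0 0 / c *: delta_mx 0 i.
  have := uv (upper_elt w); rewrite (mem_morphim (upper_morphism _ _)) ?inE // /lam urE.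
  move=> /(_ isT) E; have -> : x = w *m u - w *m v.
    rewrite -mulmxBr -scalemxAl -rowE; apply/matrixP=> j k.
    by rewrite !ord1 mxE [row _ _ _ _]mxE divfK.
  by rewrite psiD E -psiD subrr psi0.
- rewrite card_injm ?cardsT ?card_mx ?muln1 ?mul1n //.
  by apply/injmP=> w w' _ _; apply: upper_elt_inj.
- move=> u _ _ /morphimP[Z _ _ ->] /morphimP[w _ _ ->].
  by rewrite /lam /act drE conjg_upper_lift !urE mulmxA.
- move=> u; have [r Rr [Z PZ ->]] := Rtrans u; exists r => //.
  by exists (lift_elt Z); rewrite ?liftP // /act drE.
- move=> r s _ Rr Rs /morphimP[Z _ PZ ->]; rewrite /act drE; exact: Rinj.
- move=> r _; apply/setP=> g; rewrite inE.
  apply/morphimP/andP=> [[Z _ /setIP[PZ]]|[/morphimP[Z _ PZ ->]]].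
    by rewrite inE => Zr ->; rewrite liftP /act drE.
  by rewrite /act drE => Zr; exists Z; rewrite ?in_setT // in_setI PZ inE.
- apply: morphim_abelian; apply/centsP=> w _ w' _; exact: addrC.
Qed.

(** * The orbits of [Pn] and their stabilizers, case by case *)

Lemma Pn_block m (v : 'cV[F]_m) (A : 'M_m) : A \in unitmx ->
  exists2 Z, Z \in Pn F m.+1 & GLval Z = block_mx 1%:M 0 v A :> 'M_(1 + m).
Proof.
move=> uA; pose B : 'M_(1 + m) := block_mx 1%:M 0 v A.
have BE : GLval (GL_of B) = B.
  by rewrite GL_ofK // unitmxE (@det_lblock _ 1 m) det1 mul1r -unitmxE.
by exists (GL_of B) => //; apply/PnP; exists v, A.
Qed.

Lemma mul_Pn_col m (v : 'cV[F]_m) (A : 'M_m) (a : F) (b : 'cV_m) :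
  block_mx 1%:M 0 v A *m col_mx a%:M b = col_mx a%:M (a *: v + A *m b).
Proof. by rewrite mul_block_col mul1mx mul0mx addr0 mul_mx_scalar. Qed.

(** The lower block becomes [a *: v + A *m b]; as [a] is invertible, [v] alone moves it anywhere. *)
Lemma Pn_orbit_nonzero_head m (a : F) (b : 'cV[F]_m) : a != 0 ->
  Pn_orbit (col_mx a%:M b : 'cV_(1 + m)) = [set col_mx a%:M b' | b' : 'cV_m].
Proof.
move=> a0; apply/setP=> u; apply/imsetP/imsetP=> [[Z /PnP[v [A _ ->]] ->]|[b' _ ->]].
  by exists (a *: v + A *m b) => //; rewrite -mul_Pn_col.
have [Z PZ ZE] := Pn_block (a^-1 *: (b' - b)) (unitmx1 F m).
exists Z; rewrite // ZE mul_Pn_col scalerA divff // scale1r mul1mx.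
by rewrite subrK.
Qed.

(** With zero head the block [v] has no effect, and the invertible [A] act transitively on nonzero
    columns. *)
Lemma Pn_orbit_zero_head m (b : 'cV[F]_m.+1) : b != 0 ->
  Pn_orbit (col_mx 0%:M b : 'cV_(1 + m.+1)) =
    [set (col_mx 0%:M b' : 'cV_(1 + m.+1)) | b' in [set~ 0 : 'cV[F]_m.+1]].
Proof.
move=> b0; apply/setP=> u.
apply/imsetP/imsetP=> [[Z /PnP[v [A uA ->]] ->]|[b']].
  exists (A *m b); last by rewrite mul_Pn_col scale0r add0r.
  by rewrite !inE; apply: contraNneq b0 => Ab; rewrite -(mulKmx uA b) Ab mulmx0.
rewrite !inE => /nonzero_col_transitive[B uB ->] ->.
have [C uC bE] := nonzero_col_transitive b0.
(* This matrix carries [C *m delta_mx 0 0] to [B *m delta_mx 0 0]. *)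
have uBC : B *m invmx C \in unitmx by rewrite unitmx_mul uB unitmx_inv.
have [Z PZ ZE] := Pn_block 0 uBC; exists Z => //.
by rewrite ZE mul_Pn_col scale0r add0r bE -mulmxA mulKmx.
Qed.

Lemma card_Pn_orbit_nonzero_head m (a : F) : a != 0 ->
  #|Pn_orbit (col_mx a%:M 0 : 'cV_(1 + m))| = (#|F| ^ m)%N.
Proof.
move=> a0; rewrite Pn_orbit_nonzero_head // card_imset.
  by rewrite card_mx muln1.
by move=> b b' /(@eq_col_mx _ 1 m 1)[].
Qed.

Lemma card_Pn_orbit_zero_head m (b : 'cV[F]_m.+1) : b != 0 ->
  #|Pn_orbit (col_mx 0%:M b : 'cV_(1 + m.+1))| = (#|F| ^ m.+1 - 1)%N.
Proof.
move=> b0; rewrite Pn_orbit_zero_head // card_imset.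
  by rewrite cardsC1 card_mx muln1 subn1.
by move=> c c' /(@eq_col_mx _ 1 m.+1 1)[].
Qed.

Lemma card_Pn_orbit0 m : #|Pn_orbit (0 : 'cV[F]_m.+1)| = 1%N.
Proof.
rewrite -[RHS](cards1 (0 : 'cV[F]_m.+1)); apply: eq_card => u; rewrite !inE.
apply/imsetP/eqP=> [[Z _ ->]|->]; first exact: mulmx0.
by exists 1%g; rewrite ?group1 // mulmx0.
Qed.

(** The lower block of the image is [a *: v], so fixing the vector forces [v = 0] and leaves [A]
    free. *)
Lemma stab_col_nonzero_head m (a : F) : a != 0 ->
  Pn F m.+2 :&: stab_col (col_mx a%:M 0 : 'cV_(1 + m.+1)) = lift_GLn F m.+1.
Proof.
move=> a0; rewrite lift_GLnE; apply/setP=> g; rewrite in_setI.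
apply/andP/morphimP=> [[/PnP[v [A uA gE]]]|[Z _ _ ->]].
  rewrite inE gE mul_Pn_col mulmx0 addr0 => /eqP/(@eq_col_mx _ 1 m.+1 1)[_ /eqP].
  rewrite scaler_eq0 (negPf a0) /= => /eqP v0.
  exists (GL_of A); rewrite ?in_setT //; apply: GLval_inj.
  by rewrite lift_eltE GL_ofK // gE v0.
split; last by rewrite inE lift_eltE mul_Pn_col scaler0 add0r mulmx0.
by apply/PnP; exists 0, (GLval Z); rewrite ?GLval_unitmx // lift_eltE.
Qed.

Lemma stab_col_GLn_isog m (a : F) : a != 0 ->
  (Pn F m.+2 :&: stab_col (col_mx a%:M 0 : 'cV_(1 + m.+1)))%G \isog GLn F m.+1.
Proof.
move=> a0; rewrite isog_sym; have := GLn_isog F m.+1.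
by rewrite -(stab_col_nonzero_head m a0).
Qed.

Lemma Pn1 : Pn F 1 = 1%G.
Proof.
apply/val_inj/setP=> g; rewrite inE; apply/forallP/set1P=> [g0|-> j].
  by apply: GLval_inj; apply/matrixP=> i j; rewrite !ord1 (eqP (g0 0)) !mxE.
by rewrite GL_1E mxE.
Qed.

Lemma rep_zeta_Tn_step m :
  rep_zeta (Tn F m.+3) =
    (#|F|%:R - 1) * (rep_zeta (GLn F m.+1) \Po 'X^(#|F| ^ m.+1))
    + (rep_zeta (Tn F m.+2) \Po 'X^(#|F| ^ m.+1 - 1))
    + rep_zeta (Pn F m.+2).
Proof.
(* Orbit representatives: [r a] for each head [a], with [r 0] the fixed vector, and [e1] for the
   nonzero columns of head 0. *)
pose r a : 'cV[F]_m.+2 := (col_mx a%:M 0 : 'cV_(1 + m.+1)).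
pose e : 'cV[F]_m.+1 := delta_mx 0 0.
pose e1 : 'cV[F]_m.+2 := (col_mx 0%:M e : 'cV_(1 + m.+1)).
have e0 : e != 0.
  by apply/eqP=> /matrixP/(_ 0 0)/eqP; rewrite !mxE oner_eq0.
have scalar_inj (a a' : F) : a%:M = a'%:M :> 'M_1 -> a = a'.
  by move/matrixP/(_ 0 0); rewrite !mxE.
have r_inj : injective r by move=> a a' /(@eq_col_mx _ 1 m.+1 1)[/scalar_inj].
have e1r : e1 \notin [set r a | a in F].
  apply/imsetP=> -[a _ /(@eq_col_mx _ 1 m.+1 1)[_ E]]; by rewrite E eqxx in e0.
rewrite (@rep_zeta_Tn_orbits _ (e1 |: [set r a | a in F])); last first.
(* [Pn] preserves the head, which separates the [r a]; for head 0 it also preserves whether the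
   lower block vanishes, which separates [e1] from [r 0]. *)
- move=> r1 r2 Z; rewrite !in_setU1 => R1 R2 /PnP[v [A uA ->]].
  case/orP: R1 => [/eqP->|/imsetP[a _ ->]];
    case/orP: R2 => [/eqP->|/imsetP[a' _ ->]] //.
  + rewrite mul_Pn_col scale0r add0r => /(@eq_col_mx _ 1 m.+1 1)[_ E].
    by move: e0; rewrite -(mulKmx uA e) -E mulmx0 eqxx.
  + rewrite mul_Pn_col mulmx0 addr0 => /(@eq_col_mx _ 1 m.+1 1)[/scalar_inj <-].
    by rewrite scale0r => E; rewrite E eqxx in e0.
  + by rewrite mul_Pn_col => /(@eq_col_mx _ 1 m.+1 1)[/scalar_inj->].
- move=> u; rewrite -[u](@vsubmxK _ 1 m.+1).
  rewrite [usubmx _]mx11_scalar; set a := usubmx _ 0 0; set b := dsubmx _.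
  have [a0|a0] := eqVneq a 0; last first.
    exists (r a); first by rewrite in_setU1 imset_f ?orbT.
    have : col_mx a%:M b \in Pn_orbit (r a).
      by rewrite Pn_orbit_nonzero_head // imset_f.
    by case/imsetP=> Z PZ ->; exists Z.
  have [->|b0] := eqVneq b 0.
    exists (r a); first by rewrite in_setU1 imset_f ?orbT.
    by exists 1%g; rewrite ?group1 // mul1mx.
  exists e1; first by rewrite setU11.
  have : col_mx a%:M b \in Pn_orbit e1.
    by rewrite Pn_orbit_zero_head // a0 imset_f // !inE.
  by case/imsetP=> Z PZ ->; exists Z.
rewrite big_setU1 //= big_imset /=; last by move=> a a' _ _; apply: r_inj.
(* The term of [r 0] is split off and moved last; the terms of the other [r a] are all equal. *)
rewrite (bigD1 0) //= addrC -addrA addrC.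
rewrite (eq_bigr (fun=> rep_zeta (GLn F m.+1) \Po 'X^(#|F| ^ m.+1))); last first.
  move=> a a0; rewrite card_Pn_orbit_nonzero_head //.
  by rewrite (rep_zeta_isog (stab_col_GLn_isog m a0)).
have cardF1 : #|F|.-1%:R = #|F|%:R - 1 :> {poly int}.
  by rewrite -subn1 natrB // ltnW ?finNzRing_gt1.
rewrite sumr_const cardC1 -[_ *+ _.-1]mulr_natl cardF1.
have -> : r 0 = 0 by rewrite /r raddf0 col_mx0.
rewrite card_Pn_orbit0 card_Pn_orbit_zero_head // expr1 comp_polyXr.
(* As a column of height [m.+2], [e1] is the second basis vector. *)
rewrite (rep_zeta_isog (stab_col_Tn_isog _)); last first.
  rewrite /e1; apply/matrixP=> i j; rewrite !ord1.
  case: (@split_ordP 1 m.+1 i) => k ->.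
    by rewrite (@col_mxEu _ 1 m.+1 1) ord1 !mxE.
  by rewrite (@col_mxEd _ 1 m.+1 1) !mxE.
suff -> : (Pn F m.+2 :&: stab_col 0)%G = Pn F m.+2 by [].
by apply/val_inj/setIidPl/subsetP=> Z _; rewrite inE mulmx0.
Qed.

End StabilizersAndOrbits.

Theorem proposition4 (F : finFieldType) (q : nat) (hq : q = #|F|) :
  (forall m : nat,
     [/\ (upper_unip F m.+1 ><| lift_Pn F m)%g = Tn F m.+2,
         [set: 'rV[F]_m.+1] \isog upper_unip F m.+1
       & Pn F m.+1 \isog lift_Pn F m] /\
     [/\ (lower_unip F m ><| lift_GLn F m)%g = Pn F m.+1,
         [set: 'cV[F]_m] \isog lower_unip F m
       & GLn F m \isog lift_GLn F m]) /\
  rep_zeta (Tn F 2) = q%:R * 'X /\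
  (forall n : nat, (3 <= n)%N ->
     rep_zeta (Tn F n) =
       (q%:R - 1) * (rep_zeta (GLn F (n - 2)) \Po 'X^(q ^ (n - 2)))
       + (rep_zeta (Tn F (n - 1)) \Po 'X^(q ^ (n - 2) - 1))
       + rep_zeta (Pn F (n - 1))).
Proof.
rewrite {}hq; split=> [m|]; first split.
- split; [exact: sdprod_Tn | exact: upper_unip_isog |].
  by rewrite lift_PnE; apply: lift_isog.
- split; [exact: sdprod_Pn | exact: lower_unip_isog | exact: GLn_isog].
split=> [|[|[|[|m]]] // _].
  (* The complement is the trivial group [Pn F 1], so [Tn F 2] is abelian of order [#|F|]. *)
  have T2 : upper_unip F 1 = Tn F 2.
    by rewrite -sdprod_Tn lift_PnE Pn1 morphim1 sdprodg1 //.
  have := upper_unip_isog F 1; rewrite T2 => isoT.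
  rewrite rep_zeta_abelian -?(isog_abelian isoT) -?(card_isog isoT).
    by rewrite cardsT card_mx muln1.
  by apply/centsP=> w _ w' _; apply: addrC.
by rewrite !subSS subn0 rep_zeta_Tn_step.
Qed.
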